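(* Let $R$ be a commutative ring with identity, let $(X,x_0,k_X,m_X)$ and $(Y,y_0,k_Y,m_Y)$ be digital Hopf spaces, and let $f:X\to Y$ be a digital Hopf function. Then $$f^*(PdH^*(Y;R))\subseteq PdH^*(X;R),$$ where $PdH^*(W;R)\subseteq dH^*(W;R)$ denotes the submodule of digital primitive cohomology classes of the digital Hopf space $W$.
   Context: A digital image is a pair $(X,k_X)$ where $X$ is a finite subset of some $\mathbb{Z}^n$ and $k_X$ is an adjacency relation (symmetric, irreflexive) on $X$. The basic examples are the $k(u,n)$-adjacencies, $1\le u\le n$: distinct $p,q\in\mathbb{Z}^n$ are $k(u,n)$-adjacent if $|p_i-q_i|=1$ for at most $u$ indices $i$ and $p_j=q_j$ for all other indices $j$. A subset $A\subseteq X$ is $k_X$-connected if any two distinct points of $A$ are joined by a finite sequence of distinct points of $A$ in which consecutive points are $k_X$-adjacent. A function $f:X\to Y$ is $(k_X,k_Y)$-continuous if it sends every $k_X$-connected subset of $X$ to a $k_Y$-connected subset of $Y$. A pointed digital image $(X,x_0,k_X)$ has a chosen base point $x_0\in X$. Homotopy: a digital $(k_X,k_Y)$-homotopy between continuous $f,g:X\to Y$ is a function $F:X\times[0,m]_{\mathbb{Z}}\to Y$ for some positive integer $m$, where $[0,m]_{\mathbb{Z}}=\{0,1,\dots,m\}$ has 2-adjacency (consecutive integers), with $F(x,0)=f(x)$, $F(x,m)=g(x)$, each $F(x,\cdot):[0,m]_{\mathbb{Z}}\to Y$ being $(2,k_Y)$-continuous and each $F(\cdot,t):X\to Y$ being $(k_X,k_Y)$-continuous.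 It is pointed if $F(x_0,t)=y_0$ for all $t$. Products: the Cartesian product $X\times Y$ of digital images is regarded as a digital image with an adjacency relation $k_{X\times Y}$ for which coordinate inclusions, projections, diagonal maps, switching maps and products $f\times g$ of continuous functions are continuous. Digital Hopf space $(Y,y_0,k_Y,m_Y)$: a pointed digital image $(Y,y_0,k_Y)$ with a $(k_{Y\times Y},k_Y)$-continuous $m_Y:Y\times Y\to Y$ such that $y\mapsto m_Y(y_0,y)$ and $y\mapsto m_Y(y,y_0)$ are both pointed digitally homotopic to $1_Y$. A digital Hopf function $f:X\to Y$ between digital Hopf spaces is a $(k_X,k_Y)$-continuous function such that $f\circ m_X$ and $m_Y\circ(f\times f)$ are digitally homotopic. Cohomology: $\Delta^n=\{e_0,\dots,e_n\}\subset\mathbb{Z}^{n+1}$ (standard basis vectors, ordered by index) with $k(2,n+1)$-adjacency, so any two distinct points are adjacent. $dC_n(X;R)$ is the free $R$-module on all continuous functions $\sigma:\Delta^n\to X$; $\partial_n\sigma=\sum_{i=0}^n(-1)^i\sigma\circ\epsilon_i^n$ for $n\ge1$, where $\epsilon_i^n:\Delta^{n-1}\to\Delta^n$ is the order-preserving injection omitting $e_i$; $\partial_0=0$. $dH^n(X;R)$ is the $n$th cohomology of the cochain complex $\operatorname{Hom}_R(dC_*(X;R),R)$; a continuous $f:X\to Y$ induces $f^*:dH^*(Y;R)\to dH^*(X;R)$ by dualizing the chain map $\sigma\mapsto f\circ\sigma$. A class $y\in dH^*(Y;R)$ of a digital Hopf space $Y$ is a digital primitive cohomology class if $m_Y^*(y)=p_1^*(y)+p_2^*(y)$,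 where $p_1,p_2:Y\times Y\to Y$ are the first and second projections. *)

(* Defs.v *)
From HB Require Import structures.
From mathcomp Require Import all_boot all_order all_algebra finmap.
From mathcomp Require Import boolp classical_sets functions.

Set Implicit Arguments.
Unset Strict Implicit.
Unset Printing Implicit Defensive.

Import GRing.Theory Num.Theory.
Local Open Scope ring_scope.
Local Open Scope quotient_scope.

Record dimage := DImage {
  ambient : nat;
  pts : {fset 'rV[int]_ambient};
  adj : rel pts;
  adj_sym : symmetric adj;
  adj_irr : irreflexive adj }.

Definition carrier (X : dimage) : finType := pts X.
Coercion carrier : dimage >-> Finite.type.

Definition kadj (u n : nat) (p q : 'rV[int]_n) : bool :=
  [&& p != q,
      (#|[set i | (`|p 0 i - q 0 i| == 1)%R]| <= u)%N
    & [forall i, (`|p 0 i - q 0 i| == 1) || (p 0 i == q 0 i)]].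

Lemma kadj_sym u n : symmetric (@kadj u n).
Proof.
move=> p q; rewrite /kadj eq_sym; congr [&& _, _ & _].
  by congr (_ <= _)%N; apply: eq_card => i; rewrite !inE distrC.
by apply: eq_forallb => i; rewrite distrC [q 0 i == _]eq_sym.
Qed.

Lemma kadj_irr u n : irreflexive (@kadj u n).
Proof. by move=> p; rewrite /kadj eqxx. Qed.

Definition kimage (u n : nat) (A : {fset 'rV[int]_n}) : dimage :=
  @DImage n A (fun p q => kadj u (val p) (val q))
    (fun p q => kadj_sym u (val p) (val q)) (fun p => kadj_irr u (val p)).

Definition dconnected (X : dimage) (A : {set X}) : Prop :=
  forall x y : X, x \in A -> y \in A -> x != y ->
  exists s : seq X,
    [/\ path (@adj X) x s, last x s = y, uniq (x :: s)
      & {subset x :: s <= A}].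

Definition dcontinuous (X Y : dimage) (f : X -> Y) : Prop :=
  forall A : {set X}, dconnected A -> dconnected (f @: A).

Definition dmap (X Y : dimage) : Type :=
  {f : {ffun X -> Y} | `[< dcontinuous f >]}.

HB.instance Definition _ (X Y : dimage) := Finite.copy (dmap X Y)
  {f : {ffun X -> Y} | `[< dcontinuous f >]}.

Definition dmap_fun (X Y : dimage) (f : dmap X Y) : X -> Y := val f.
Coercion dmap_fun : dmap >-> Funclass.

Lemma dmap_cont (X Y : dimage) (f : dmap X Y) : dcontinuous f.
Proof. exact/asboolP/(valP f). Qed.

Arguments dmap_cont {X Y} f.

Lemma dmapP (X Y : dimage) (f g : dmap X Y) : f =1 g -> f = g.
Proof. by move=> fg; apply/val_inj/ffunP. Qed.

Lemma dmap_subproof (X Y : dimage) (f : X -> Y) :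
  dcontinuous f -> `[< dcontinuous (finfun f) >].
Proof.
move=> cf; apply/asboolP => A /cf; congr dconnected.
by apply: eq_imset => x; rewrite ffunE.
Qed.

Definition mk_dmap (X Y : dimage) (f : X -> Y) (cf : dcontinuous f) :
  dmap X Y := exist _ (finfun f) (dmap_subproof cf).

Lemma mk_dmapE (X Y : dimage) (f : X -> Y) (cf : dcontinuous f) :
  mk_dmap cf =1 f.
Proof. by move=> x; rewrite /dmap_fun /= ffunE. Qed.

Lemma dcontinuous_comp (X Y Z : dimage) (g : Y -> Z) (f : X -> Y) :
  dcontinuous g -> dcontinuous f -> dcontinuous (fun x => g (f x)).
Proof. by move=> cg cf A /cf /cg; rewrite -imset_comp. Qed.

Definition dcomp (X Y Z : dimage) (g : dmap Y Z) (f : dmap X Y) : dmap X Z :=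
  mk_dmap (dcontinuous_comp (dmap_cont g) (dmap_cont f)).

Lemma dcompE (X Y Z : dimage) (g : dmap Y Z) (f : dmap X Y) x :
  dcomp g f x = g (f x).
Proof. exact: mk_dmapE. Qed.

(* [0, m] with the 2-adjacency of Z, that is k(1, 1). *)
Definition dinterval (m : nat) : dimage :=
  kimage 1 [fset (const_mx i%:Z : 'rV[int]_1) | i in iota 0 m.+1]%fset.

Lemma ipt_subproof m (i : 'I_m.+1) : const_mx (i : nat)%:Z \in pts (dinterval m).
Proof. by apply/imfsetP; exists (i : nat); rewrite ?[_ \in _]mem_iota ?ltn_ord. Qed.

Definition ipt m (i : 'I_m.+1) : dinterval m := [` ipt_subproof i]%fset.

Definition is_dhomotopy (X Y : dimage) (f g : X -> Y) (m : nat)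
    (F : X -> dinterval m -> Y) : Prop :=
  [/\ forall x, F x (ipt ord0) = f x,
      forall x, F x (ipt ord_max) = g x,
      forall x, dcontinuous (F x)
    & forall t, dcontinuous (F^~ t)].

Definition dhomotopic (X Y : dimage) (f g : X -> Y) : Prop :=
  exists m : nat, (0 < m)%N /\
  exists F : X -> dinterval m -> Y, is_dhomotopy f g F.

Definition pointed_dhomotopic (X Y : dimage) (x0 : X) (y0 : Y)
    (f g : X -> Y) : Prop :=
  exists m : nat, (0 < m)%N /\
  exists F : X -> dinterval m -> Y,
    is_dhomotopy f g F /\ forall t, F x0 t = y0.

Definition prod_pts (X Y : dimage) : {fset 'rV[int]_(ambient X + ambient Y)} :=
  [fset row_mx x y | x in pts X, y in pts Y]%fset.

Record prod_adjacency := ProdAdjacency {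
  padj : forall X Y : dimage, rel (prod_pts X Y);
  padj_sym : forall X Y, symmetric (@padj X Y);
  padj_irr : forall X Y, irreflexive (@padj X Y) }.

Definition dprod (K : prod_adjacency) (X Y : dimage) : dimage :=
  DImage (@padj_sym K X Y) (@padj_irr K X Y).

Lemma ppair_subproof (X Y : dimage) (x : X) (y : Y) :
  row_mx (val x) (val y) \in prod_pts X Y.
Proof.
apply/imfset2P; exists (val x); first exact: valP.
by exists (val y); first exact: valP.
Qed.

Lemma pfst_subproof (X Y : dimage) (p : prod_pts X Y) :
  lsubmx (val p) \in pts X.
Proof. by have /imfset2P[x xX [y _ ->]] := valP p; rewrite row_mxKl. Qed.

Lemma psnd_subproof (X Y : dimage) (p : prod_pts X Y) :
  rsubmx (val p) \in pts Y.
Proof. by have /imfset2P[x _ [y yY ->]] := valP p; rewrite row_mxKr. Qed.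

Section ProductMaps.
Variables (K : prod_adjacency) (X Y : dimage).

Definition ppair (x : X) (y : Y) : dprod K X Y :=
  [` ppair_subproof x y]%fset.
Definition pfst (p : dprod K X Y) : X := [` pfst_subproof p]%fset.
Definition psnd (p : dprod K X Y) : Y := [` psnd_subproof p]%fset.

Lemma ppairK1 x y : pfst (ppair x y) = x.
Proof. by apply: val_inj; rewrite /= row_mxKl. Qed.

Lemma ppairK2 x y : psnd (ppair x y) = y.
Proof. by apply: val_inj; rewrite /= row_mxKr. Qed.

Lemma ppair_eta p : ppair (pfst p) (psnd p) = p.
Proof. by apply: val_inj; rewrite /= hsubmxK. Qed.

End ProductMaps.

(* The adjacency of a product is only required to make the structural maps
   continuous, as a choice made for all pairs of digital images at once. *)
Record product_structure := ProductStructure {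
  product_adj :> prod_adjacency;
  inl_cont : forall (X Y : dimage) (y : Y),
    dcontinuous (fun x : X => ppair product_adj x y);
  inr_cont : forall (X Y : dimage) (x : X),
    dcontinuous (fun y : Y => ppair product_adj x y);
  pfst_cont : forall X Y : dimage, dcontinuous (@pfst product_adj X Y);
  psnd_cont : forall X Y : dimage, dcontinuous (@psnd product_adj X Y);
  diag_cont : forall X : dimage,
    dcontinuous (fun x : X => ppair product_adj x x);
  switch_cont : forall X Y : dimage,
    dcontinuous (fun p : dprod product_adj X Y =>
                   ppair product_adj (psnd p) (pfst p));
  pmap_cont : forall (X X' Y Y' : dimage) (f : dmap X X') (g : dmap Y Y'),
    dcontinuous (fun p : dprod product_adj X Y =>
                   ppair product_adj (f (pfst p)) (g (psnd p))) }.

Definition proj1_dmap (K : product_structure) (X Y : dimage) :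
  dmap (dprod K X Y) X := mk_dmap (@pfst_cont K X Y).
Definition proj2_dmap (K : product_structure) (X Y : dimage) :
  dmap (dprod K X Y) Y := mk_dmap (@psnd_cont K X Y).
Definition prod_dmap (K : product_structure) (X X' Y Y' : dimage)
    (f : dmap X X') (g : dmap Y Y') : dmap (dprod K X Y) (dprod K X' Y') :=
  mk_dmap (@pmap_cont K X X' Y Y' f g).

Record hopf_space (K : product_structure) := HopfSpace {
  hspace :> dimage;
  hbase : hspace;
  hmul : dmap (dprod K hspace hspace) hspace;
  hmul_1l : pointed_dhomotopic hbase hbase
    (fun y : hspace => hmul (ppair K hbase y)) (fun y : hspace => y);
  hmul_1r : pointed_dhomotopic hbase hbase
    (fun y : hspace => hmul (ppair K y hbase)) (fun y : hspace => y) }.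

Definition hopf_function (K : product_structure) (X Y : hopf_space K)
    (f : dmap X Y) : Prop :=
  dhomotopic (dcomp f (hmul X)) (dcomp (hmul Y) (prod_dmap K f f)).

Section LinearExtension.
Variables (R : comPzRingType) (I : finType).

(* As I is finite, {ffun I -> R^o} is the free R-module on I, with basis
   the family fbasis. *)
Definition fbasis (i : I) : {ffun I -> R^o} := [ffun j => (j == i)%:R].

Definition linext (M : lmodType R) (g : I -> M) (c : {ffun I -> R^o}) : M :=
  \sum_i (c i : R) *: g i.

Lemma linext_linear (M : lmodType R) (g : I -> M) : linear (linext g).
Proof.
move=> a c d; rewrite /linext scaler_sumr -big_split /=.
by apply: eq_bigr => i _; rewrite !ffunE scalerDl scalerA.
Qed.

HB.instance Definition _ (M : lmodType R) (g : I -> M) :=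
  GRing.isLinear.Build R {ffun I -> R^o} M *:%R (linext g) (linext_linear g).

Lemma linext_basis (M : lmodType R) (g : I -> M) i :
  linext g (fbasis i) = g i.
Proof.
rewrite /linext (bigD1 i) //= ffunE eqxx scale1r big1 ?addr0 // => j ji.
by rewrite ffunE (negbTE ji) scale0r.
Qed.

Lemma fbasis_ext (M : lmodType R) (u v : {linear {ffun I -> R^o} -> M}) :
  (forall i, u (fbasis i) = v (fbasis i)) -> u =1 v.
Proof.
move=> uv c; have -> : c = \sum_i (c i : R) *: fbasis i.
  apply/ffunP => j; rewrite sum_ffunE (bigD1 j) //= !ffunE eqxx.
  rewrite big1 ?addr0; first by rewrite /GRing.scale /= mulr1.
  by move=> i ij; rewrite !ffunE eq_sym (negbTE ij) /GRing.scale /= mulr0.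
by rewrite !linear_sum; apply: eq_bigr => i _; rewrite !linearZ /= uv.
Qed.

End LinearExtension.

Section Dual.
Variables (R : comPzRingType) (V : lmodType R).

Definition dual : Type := {linear V -> R^o}.

Definition dual_fun (f : dual) : V -> R^o := f : {linear V -> R^o}.
Coercion dual_fun : dual >-> Funclass.

Lemma dual_ext (f g : dual) : f =1 g -> f = g.
Proof.
rewrite /dual_fun; move: f g => [f cf] [g cg] /= fg.
have {}fg : f = g by apply/funext.
subst g; congr GRing.Linear.Pack.
move: cf cg => [[a1] [b1]] [[a2] [b2]].
by rewrite (Prop_irrelevance a1 a2) (Prop_irrelevance b1 b2).
Qed.

HB.instance Definition _ := gen_eqMixin dual.
HB.instance Definition _ := gen_choiceMixin dual.

Definition dual_zero : dual := (\0 : V -> R^o) : {linear V -> R^o}.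
Definition dual_opp (f : dual) : dual :=
  (\- (f : {linear V -> R^o}) : V -> R^o) : {linear V -> R^o}.
Definition dual_add (f g : dual) : dual :=
  ((f : {linear V -> R^o}) \+ (g : {linear V -> R^o}) : V -> R^o)
    : {linear V -> R^o}.
Definition dual_scale (a : R) (f : dual) : dual :=
  (a \*: (f : {linear V -> R^o}) : V -> R^o) : {linear V -> R^o}.

Lemma dual_addA : associative dual_add.
Proof. by move=> f g h; apply: dual_ext => x; apply: addrA. Qed.
Lemma dual_addC : commutative dual_add.
Proof. by move=> f g; apply: dual_ext => x; apply: addrC. Qed.
Lemma dual_add0 : left_id dual_zero dual_add.
Proof. by move=> f; apply: dual_ext => x; apply: add0r. Qed.
Lemma dual_addN : left_inverse dual_zero dual_opp dual_add.
Proof. by move=> f; apply: dual_ext => x; apply: addNr. Qed.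

HB.instance Definition _ :=
  GRing.isZmodule.Build dual dual_addA dual_addC dual_add0 dual_addN.

Lemma dual_scaleA a b f :
  dual_scale a (dual_scale b f) = dual_scale (a * b) f.
Proof. by apply: dual_ext => x; apply: scalerA. Qed.
Lemma dual_scale1 : left_id 1 dual_scale.
Proof. by move=> f; apply: dual_ext => x; apply: scale1r. Qed.
Lemma dual_scaleDr : right_distributive dual_scale +%R.
Proof. by move=> a f g; apply: dual_ext => x; apply: scalerDr. Qed.
Lemma dual_scaleDl f : {morph dual_scale^~ f : a b / a + b}.
Proof. by move=> a b; apply: dual_ext => x; apply: scalerDl. Qed.

HB.instance Definition _ := GRing.Zmodule_isLmodule.Build R dual
  dual_scaleA dual_scale1 dual_scaleDr dual_scaleDl.

End Dual.

Section DualMap.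
Variables (R : comPzRingType) (V W : lmodType R) (u : {linear V -> W}).

Definition dualmap (f : dual W) : dual V :=
  ((f : {linear W -> R^o}) \o u : V -> R^o) : {linear V -> R^o}.

Lemma dualmap_linear : linear dualmap.
Proof. by move=> a f g; apply: dual_ext. Qed.

HB.instance Definition _ :=
  GRing.isLinear.Build R (dual W) (dual V) *:%R dualmap dualmap_linear.

End DualMap.

(* The cohomology ker e / im d at V of U -d-> V -e-> W; the quotient makes
   sense for all linear maps d and e, as im d is cut down to ker e. *)
Section Cohomology.
Variables (R : pzRingType) (U V W : lmodType R).
Variables (d : {linear U -> V}) (e : {linear V -> W}).

Definition ker_pred : {pred V} := [pred x | e x == 0].

Lemma ker_pred_closed : submod_closed ker_pred.
Proof.
split=> [|a x y]; rewrite !inE ?linear0 // => /eqP ex /eqP ey.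
by rewrite linearP ex ey scaler0 addr0.
Qed.

HB.instance Definition _ :=
  GRing.isSubmodClosed.Build R V ker_pred ker_pred_closed.

Record cocycle := Cocycle { cocycle_val : V; _ : cocycle_val \in ker_pred }.

HB.instance Definition _ := [isSub for cocycle_val].
HB.instance Definition _ := [Choice of cocycle by <:].
HB.instance Definition _ := [SubChoice_isSubLmodule of cocycle by <:].

Definition cobound_pred : {pred cocycle} :=
  [pred z : cocycle | `[< exists x, val z = d x >]].

Lemma cobound_pred_closed : submod_closed cobound_pred.
Proof.
split=> [|a y z]; rewrite !inE; first by exists 0; rewrite !linear0.
move=> [x yx] [x' zx']; exists (a *: x + x').
by rewrite linearP -yx -zx' linearP.
Qed.

HB.instance Definition _ :=
  GRing.isSubmodClosed.Build R cocycle cobound_pred cobound_pred_closed.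

Definition cohomology : Type := Quotient.quot cobound_pred.

HB.instance Definition _ := GRing.Zmodule.on cohomology.
HB.instance Definition _ := EqQuotient.on cohomology.

Definition coh_class (z : cocycle) : cohomology := \pi_cohomology z.

Lemma coh_classK (c : cohomology) : coh_class (repr c) = c.
Proof. exact: reprK. Qed.

Lemma coh_class_eq (y z : cocycle) :
  coh_class y = coh_class z <-> exists x, val y - val z = d x.
Proof.
have E : (y - z \in cobound_pred) = (coh_class y == coh_class z).
  exact: Quotient.idealrBE.
rewrite inE in E; split=> [/eqP|]; first by rewrite -E => /asboolP.
by move=> yz; apply/eqP; rewrite -E; apply/asboolP.
Qed.

Lemma coh_class_repr (z : cocycle) :
  exists x, val (repr (coh_class z)) - val z = d x.
Proof. by apply/coh_class_eq; rewrite coh_classK. Qed.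

Lemma coh_class_add : {morph coh_class : y z / y + z}.
Proof. by move=> y z; rewrite /coh_class !piE. Qed.

Definition coh_scale (a : R) (c : cohomology) : cohomology :=
  coh_class (a *: repr c).

Lemma coh_scaleE a z : coh_scale a (coh_class z) = coh_class (a *: z).
Proof.
apply/coh_class_eq; have [x xz] := coh_class_repr z.
by exists (a *: x); rewrite [RHS]linearZ /= -xz scalerBr !linearZ.
Qed.

Lemma coh_scaleA a b c : coh_scale a (coh_scale b c) = coh_scale (a * b) c.
Proof. by rewrite -[c]coh_classK !coh_scaleE scalerA. Qed.
Lemma coh_scale1 : left_id 1 coh_scale.
Proof. by move=> c; rewrite -[c]coh_classK coh_scaleE scale1r. Qed.
Lemma coh_scaleDr : right_distributive coh_scale +%R.
Proof.
move=> a b c; rewrite -[b]coh_classK -[c]coh_classK -coh_class_add.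
by rewrite !coh_scaleE scalerDr coh_class_add.
Qed.
Lemma coh_scaleDl c : {morph coh_scale^~ c : a b / a + b}.
Proof.
by move=> a b; rewrite -[c]coh_classK !coh_scaleE scalerDl coh_class_add.
Qed.

HB.instance Definition _ := GRing.Zmodule_isLmodule.Build R cohomology
  coh_scaleA coh_scale1 coh_scaleDr coh_scaleDl.

End Cohomology.

Section CohomologyMap.
Variables (R : pzRingType) (U V W U' V' W' : lmodType R).
Variables (d : {linear U -> V}) (e : {linear V -> W}).
Variables (d' : {linear U' -> V'}) (e' : {linear V' -> W'}).
Variables (u : {linear U -> U'}) (v : {linear V -> V'}) (w : {linear W -> W'}).
Hypothesis vd : forall x, v (d x) = d' (u x).
Hypothesis we : forall y, w (e y) = e' (v y).

Lemma cocycle_map_subproof (z : cocycle e) : v (val z) \in ker_pred e'.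
Proof. by case: z => y /=; rewrite !inE -we => /eqP ->; rewrite linear0. Qed.

Definition cocycle_map (z : cocycle e) : cocycle e' :=
  Cocycle (cocycle_map_subproof z).

Definition coh_map (c : cohomology d e) : cohomology d' e' :=
  coh_class d' (cocycle_map (repr c)).

Lemma coh_mapE (z : cocycle e) :
  coh_map (coh_class d z) = coh_class d' (cocycle_map z).
Proof.
apply/coh_class_eq; have [x xz] := coh_class_repr d z.
by exists (u x); rewrite /= -linearB xz vd.
Qed.

Lemma coh_map_linear : linear coh_map.
Proof.
move=> a b c; rewrite -[b]coh_classK -[c]coh_classK.
rewrite -[a *: coh_class _ (repr b)]/(coh_scale a _) coh_scaleE.
rewrite -coh_class_add !coh_mapE -[a *: coh_class _ _]/(coh_scale a _).
rewrite coh_scaleE -coh_class_add; congr coh_class.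
by apply: val_inj; rewrite /= !linearP.
Qed.

End CohomologyMap.

Section DirectSum.
Variables (R : pzRingType) (V : nat -> lmodType R).

Definition dfamily : Type := forall n, V n.

HB.instance Definition _ := Choice.copy dfamily (forall n, V n).

Definition dfam_zero : dfamily := fun=> 0.
Definition dfam_opp (x : dfamily) : dfamily := fun n => - x n.
Definition dfam_add (x y : dfamily) : dfamily := fun n => x n + y n.
Definition dfam_scale (a : R) (x : dfamily) : dfamily := fun n => a *: x n.

Lemma dfam_addA : associative dfam_add.
Proof. by move=> x y z; apply: functional_extensionality_dep => n; apply: addrA. Qed.
Lemma dfam_addC : commutative dfam_add.
Proof. by move=> x y; apply: functional_extensionality_dep => n; apply: addrC. Qed.
Lemma dfam_add0 : left_id dfam_zero dfam_add.
Proof. by move=> x; apply: functional_extensionality_dep => n; apply: add0r. Qed.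
Lemma dfam_addN : left_inverse dfam_zero dfam_opp dfam_add.
Proof. by move=> x; apply: functional_extensionality_dep => n; apply: addNr. Qed.

HB.instance Definition _ :=
  GRing.isZmodule.Build dfamily dfam_addA dfam_addC dfam_add0 dfam_addN.

Lemma dfam_scaleA a b x : dfam_scale a (dfam_scale b x) = dfam_scale (a * b) x.
Proof. by apply: functional_extensionality_dep => n; apply: scalerA. Qed.
Lemma dfam_scale1 : left_id 1 dfam_scale.
Proof. by move=> x; apply: functional_extensionality_dep => n; apply: scale1r. Qed.
Lemma dfam_scaleDr : right_distributive dfam_scale +%R.
Proof. by move=> a x y; apply: functional_extensionality_dep => n; apply: scalerDr. Qed.
Lemma dfam_scaleDl x : {morph dfam_scale^~ x : a b / a + b}.
Proof. by move=> a b; apply: functional_extensionality_dep => n; apply: scalerDl. Qed.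

HB.instance Definition _ := GRing.Zmodule_isLmodule.Build R dfamily
  dfam_scaleA dfam_scale1 dfam_scaleDr dfam_scaleDl.

Definition finsupp_pred : {pred dfamily} :=
  [pred x : dfamily | `[< exists N, forall n, (N <= n)%N -> x n = 0 >]].

Lemma finsupp_closed : submod_closed finsupp_pred.
Proof.
split=> [|a x y]; rewrite !inE; first by exists 0%N.
move=> [N xN] [M yM]; exists (maxn N M) => n; rewrite geq_max => /andP[Nn Mn].
change (a *: x n + y n = 0).
rewrite (xN n Nn) (yM n Mn) scaler0; exact: addr0.
Qed.

HB.instance Definition _ :=
  GRing.isSubmodClosed.Build R dfamily finsupp_pred finsupp_closed.

Record dsum := DSum { dsum_val : dfamily; _ : dsum_val \in finsupp_pred }.

HB.instance Definition _ := [isSub for dsum_val].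
HB.instance Definition _ := [Choice of dsum by <:].
HB.instance Definition _ := [SubChoice_isSubLmodule of dsum by <:].

Definition dsum_fun (x : dsum) (n : nat) : V n := dsum_val x n.
Coercion dsum_fun : dsum >-> Funclass.

Lemma dsum_ext (x y : dsum) : (forall n, x n = y n) -> x = y.
Proof.
by move=> xy; apply: val_inj; apply: functional_extensionality_dep.
Qed.

End DirectSum.

Section DirectSumMap.
Variables (R : pzRingType) (V W : nat -> lmodType R).
Variable f : forall n, {linear V n -> W n}.

Lemma dsum_map_subproof (x : dsum V) :
  (fun n => f n (x n)) \in @finsupp_pred R W.
Proof.
case: x => x px; have /asboolP[N xN] := px.
by apply/asboolP; exists N => n /xN x0; rewrite /dsum_fun /= x0 linear0.
Qed.

Definition dsum_map (x : dsum V) : dsum W := DSum (dsum_map_subproof x).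

Lemma dsum_map_linear : linear dsum_map.
Proof. by move=> a x y; apply: dsum_ext => n; apply: linearP. Qed.

HB.instance Definition _ :=
  GRing.isLinear.Build R (dsum V) (dsum W) *:%R dsum_map dsum_map_linear.

End DirectSumMap.

Definition dsimplex (n : nat) : dimage :=
  kimage 2 [fset (delta_mx 0 i : 'rV[int]_n.+1) | i in 'I_n.+1]%fset.

Lemma vertex_subproof n (i : 'I_n.+1) : delta_mx 0 i \in pts (dsimplex n).
Proof. by apply/imfsetP; exists i. Qed.

Definition vertex n (i : 'I_n.+1) : dsimplex n := [` vertex_subproof i]%fset.

Lemma vertexP n (p : dsimplex n) : exists i, p = vertex i.
Proof. by have /imfsetP[i _ pi] := valP p; exists i; apply: val_inj. Qed.

Lemma dsimplex_adj n (p q : dsimplex n) : p != q -> adj p q.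
Proof.
have [i ->] := vertexP p; have [j ->] := vertexP q => ij.
have {}ij : i != j by apply: contraNneq ij => ->.
rewrite /= /kadj /=; apply/and3P; split.
- apply: contraNneq ij => /matrixP/(_ 0 i); rewrite !mxE !eqxx /=.
  by case: (i == j).
- have := cards2 i j; rewrite ij => <-; apply/subset_leq_card/fintype.subsetP => l.
  rewrite !inE !mxE /=.
  by case: (l == i); case: (l == j).
- apply/forallP => l; rewrite !mxE /=.
  by case: (l == i); case: (l == j).
Qed.

Lemma dsimplex_connected n (A : {set dsimplex n}) : dconnected A.
Proof.
move=> x y xA yA xy; exists [:: y]; split=> //=.
- by rewrite andbT; apply: dsimplex_adj.
- by rewrite inE xy.
- by move=> z; rewrite !inE => /orP[] /eqP ->.
Qed.

(* The face e_j |-> e_(lift i j) omitting e_i, as the restriction of the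
   linear map inserting a zero coordinate in position i; see faceE. *)
Lemma face_subproof n (i : 'I_n.+2) (p : dsimplex n) :
  val p *m row' i 1%:M \in pts (dsimplex n.+1).
Proof.
have [j ->] := vertexP p; apply/imfsetP; exists (lift i j) => //=.
by rewrite -rowE; apply/rowP => k; rewrite !mxE eqxx eq_sym.
Qed.

Definition face_fun n (i : 'I_n.+2) (p : dsimplex n) : dsimplex n.+1 :=
  [` face_subproof i p]%fset.

Lemma face_cont n (i : 'I_n.+2) : dcontinuous (face_fun i).
Proof. by move=> A _; apply: dsimplex_connected. Qed.

Definition face n (i : 'I_n.+2) : dmap (dsimplex n) (dsimplex n.+1) :=
  mk_dmap (@face_cont n i).

Lemma faceE n (i : 'I_n.+2) (j : 'I_n.+1) :
  face i (vertex j) = vertex (lift i j).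
Proof.
rewrite mk_dmapE; apply: val_inj => /=.
by rewrite -rowE; apply/rowP => k; rewrite !mxE eqxx eq_sym.
Qed.

Section Cochains.
Variable R : comPzRingType.

Definition dchain (n : nat) (X : dimage) : lmodType R :=
  {ffun dmap (dsimplex n) X -> R^o}.

(* The boundary goes from degree n to degree n.-1; in degree 0 it is zero. *)
Definition boundary_simplex (n : nat) (X : dimage) :
    dmap (dsimplex n) X -> dchain n.-1 X :=
  match n with
  | 0 => fun=> 0
  | m.+1 => fun s =>
      \sum_(i < m.+2) ((-1) ^+ i : R) *: fbasis R (dcomp s (face i))
  end.

Definition boundary (n : nat) (X : dimage) :
    {linear dchain n X -> dchain n.-1 X} :=
  linext (@boundary_simplex n X).

Definition chain_map (X Y : dimage) (f : dmap X Y) (n : nat) :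
    {linear dchain n X -> dchain n Y} :=
  linext (fun s : dmap (dsimplex n) X => fbasis R (dcomp f s)).

Lemma chain_map_boundary (X Y : dimage) (f : dmap X Y) n (c : dchain n X) :
  chain_map f n.-1 (boundary n X c) = boundary n Y (chain_map f n c).
Proof.
pose u : {linear dchain n X -> dchain n.-1 Y} := chain_map f n.-1 \o boundary n X.
pose v : {linear dchain n X -> dchain n.-1 Y} := boundary n Y \o chain_map f n.
apply: (@fbasis_ext _ _ _ u v) => s; rewrite /u /v /= /boundary /chain_map.
rewrite !linext_basis; case: n s {c u v} => [|n] s /=; first by rewrite linear0.
rewrite linear_sum; apply: eq_bigr => i _; rewrite linearZ /= linext_basis.
by congr (_ *: fbasis _ _); apply: dmapP => p; rewrite !mk_dmapE.
Qed.

Definition coboundary (n : nat) (X : dimage) :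
    {linear dual (dchain n.-1 X) -> dual (dchain n X)} :=
  dualmap (boundary n X).

Definition dH (X : dimage) (n : nat) : lmodType R :=
  cohomology (coboundary n X)
    (coboundary n.+1 X : {linear dual (dchain n X) -> dual (dchain n.+1 X)}).

Lemma cochain_map_coboundary (X Y : dimage) (f : dmap X Y) n
    (c : dual (dchain n.-1 Y)) :
  dualmap (chain_map f n) (coboundary n Y c) =
  coboundary n X (dualmap (chain_map f n.-1) c).
Proof.
by apply: dual_ext => x; rewrite /dual_fun /= -chain_map_boundary.
Qed.

Definition dH_map (X Y : dimage) (f : dmap X Y) (n : nat) :
    dH Y n -> dH X n :=
  coh_map (v := dualmap (chain_map f n)) (w := dualmap (chain_map f n.+1))
    _ (@cochain_map_coboundary X Y f n.+1).

Lemma dH_map_linear (X Y : dimage) (f : dmap X Y) n : linear (@dH_map X Y f n).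
Proof. exact: coh_map_linear (@cochain_map_coboundary X Y f n) _. Qed.

HB.instance Definition _ (X Y : dimage) (f : dmap X Y) n :=
  GRing.isLinear.Build R (dH Y n) (dH X n) *:%R (@dH_map X Y f n)
    (@dH_map_linear X Y f n).

Definition dHs (X : dimage) : lmodType R := dsum (dH X).

Definition dHs_map (X Y : dimage) (f : dmap X Y) : {linear dHs Y -> dHs X} :=
  dsum_map (@dH_map X Y f).

Definition PdHs (K : product_structure) (Y : hopf_space K) : set (dHs Y) :=
  [set y | dHs_map (hmul Y) y =
           dHs_map (proj1_dmap K Y Y) y + dHs_map (proj2_dmap K Y Y) y]%classic.

End Cochains.

Arguments dHs_map R {X Y} f.
Arguments PdHs R {K} Y.

(* Main.v *)
Require Import Defs.
From mathcomp Require Import all_boot all_order all_algebra finmap.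
From mathcomp Require Import boolp classical_sets.

Set Implicit Arguments.
Unset Strict Implicit.
Unset Printing Implicit Defensive.

Import GRing.Theory Num.Theory.
Local Open Scope ring_scope.

(* Digital cohomology is not invariant under digital homotopy: the 4-cycle is
   digitally contractible but has nonzero first cohomology.  In degree 0
   homotopic maps do agree, and there the usual computation applies.  In
   positive degree, finiteness of Y forces every primitive class y to vanish,
   whether or not the multiplication m has a unit.  All translations m(x, -)
   and m(-, x) fix y.  Given adjacent b <> b', the products
   m(w_1, m(w_2, ...)) over words w of length #|Y| in b and b' cannot all be
   distinct; looking at the first letter where two words with equal products
   differ gives P(m(b, c)) = P(m(b', c')) with P fixing y and c, c' adjacent or
   equal.  Changing the value of P(m(-, c)) at b' only, to P(m(b', c')), gives a
   contiguous map, which therefore fixes y too, and it identifies b and b'.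
   Composing such maps shrinks the image of a map fixing y until it is constant
   on components, and such a map acts as 0 in positive degree. *)

(** * Continuity as preservation of adjacency or equality *)

Definition adjeq (X : dimage) (x y : X) : bool := (x == y) || adj x y.

Lemma adjeq_refl (X : dimage) : reflexive (@adjeq X).
Proof. by move=> x; rewrite /adjeq eqxx. Qed.

Lemma adjeq_sym (X : dimage) : symmetric (@adjeq X).
Proof. by move=> x y; rewrite /adjeq eq_sym adj_sym. Qed.

(** Two adjacent points form a connected set. In its image, the first step of a path from [f x] to
    [f y] must leave [f x] by irreflexivity, so it reaches [f y]. *)
Lemma dcontinuous_adjeq (X Y : dimage) (f : X -> Y) (x y : X) :
  dcontinuous f -> adjeq x y -> adjeq (f x) (f y).
Proof.
move=> cf; have [->|xy] := eqVneq x y; first by rewrite !adjeq_refl.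
rewrite {1}/adjeq (negbTE xy) /= => axy.
have [->|fxy] := eqVneq (f x) (f y); first by rewrite !adjeq_refl.
have cA : dconnected [set x; y].
  have edge u v : adj u v -> u != v -> u \in [set x; y] -> v \in [set x; y] ->
      exists s, [/\ path (@adj X) u s, last u s = v, uniq (u :: s)
                  & {subset u :: s <= [set x; y]}].
    move=> auv uv uA vA; exists [:: v]; split=> //=; rewrite ?auv ?inE ?uv //.
    by move=> w; rewrite !inE => /orP[]/eqP->; [move: uA | move: vA]; rewrite !inE.
  move=> u v uA vA uv; apply: edge => //.
  move: uA vA uv; rewrite !inE => /orP[]/eqP-> /orP[]/eqP->; rewrite ?eqxx //.
  by rewrite adj_sym.
have fxA : f x \in f @: [set x; y] by apply: imset_f; rewrite !inE eqxx.
have fyA : f y \in f @: [set x; y] by apply: imset_f; rewrite !inE eqxx orbT.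
have [[|z s] [/= p l u sA]] := cf _ cA _ _ fxA fyA fxy; first by rewrite l eqxx in fxy.
have /imsetP[w] : z \in f @: [set x; y] by apply: sA; rewrite !inE eqxx orbT.
case/andP: p => az _; rewrite !inE => /orP[]/eqP wE zE.
  by rewrite zE wE adj_irr in az.
by rewrite /adjeq -wE -zE az orbT.
Qed.

(** The image of a path in [A] may stall or revisit points; [connect] absorbs the stalls and
    [shortenP] restores distinctness. *)
Lemma adjeq_dcontinuous (X Y : dimage) (f : X -> Y) :
  (forall x y, adj x y -> adjeq (f x) (f y)) -> dcontinuous f.
Proof.
move=> hf A cA _ _ /imsetP[x xA ->] /imsetP[y yA ->] fxy.
have xy : x != y by apply: contraNneq fxy => ->.
pose e := [rel u v : Y | [&& adj u v, u \in f @: A & v \in f @: A]].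
have [s [p l _ sA]] := cA x y xA yA xy.
have : connect e (f x) (f y).
  rewrite -l; elim: s x {xA xy fxy l} p sA => [|z s IH] x /=; first by rewrite connect0.
  move=> /andP[xz zs] sA; have xA : x \in A by apply: sA; rewrite inE eqxx.
  have zA : z \in A by apply: sA; rewrite !inE eqxx orbT.
  have zc : connect e (f z) (f (last z s)).
    by apply: IH => // w ws; apply: sA; rewrite inE ws orbT.
  apply: connect_trans zc; have /orP[/eqP->|axz] := hf _ _ xz; first exact: connect0.
  by apply: connect1; rewrite /= axz !imset_f.
case/connectP => s0 /shortenP[t pt ut _ lt].
exists t; split=> //; first by apply: sub_path pt => u v /andP[].
case: t pt {ut} lt => [|z t] /= pt lt; first by rewrite lt eqxx in fxy.
move=> w; rewrite inE => /orP[/eqP->|wt]; first exact: imset_f.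
have : path e (f x) (z :: t) by [].
elim: {pt lt} (z :: t) (f x) wt => //= v r IH u.
rewrite inE => /orP[/eqP->|wr] /andP[/and3P[_ _ vA] pr] //.
exact: IH wr pr.
Qed.

(** * Simplices as ordered cliques *)

Lemma vertex_inj n : injective (@vertex n).
Proof.
move=> i j ij; have /rowP/(_ i) := congr1 val ij.
by rewrite /= !mxE !eqxx /=; case: eqP => // _ /eqP; rewrite oner_eq0.
Qed.

Definition verts (X : dimage) n (s : dmap (dsimplex n) X) : seq X :=
  [seq s (vertex i) | i <- enum 'I_n.+1].

Definition clique (X : dimage) (s : seq X) : Prop := {in s &, forall x y, adjeq x y}.

Lemma size_verts (X : dimage) n (s : dmap (dsimplex n) X) : size (verts s) = n.+1.
Proof. by rewrite size_map size_enum_ord. Qed.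

Lemma nth_verts (X : dimage) n (s : dmap (dsimplex n) X) x0 (i : 'I_n.+1) :
  nth x0 (verts s) i = s (vertex i).
Proof. by rewrite (nth_map ord0) ?size_enum_ord // nth_ord_enum. Qed.

Lemma verts_inj (X : dimage) n : injective (@verts X n).
Proof.
move=> s t st; apply: dmapP => p; have [i ->] := vertexP p.
have x0 := s (vertex ord0).
by have := congr1 (fun l => nth x0 l i) st; rewrite !nth_verts.
Qed.

Lemma verts_dcomp (X Y : dimage) n (f : dmap X Y) (s : dmap (dsimplex n) X) :
  verts (dcomp f s) = map f (verts s).
Proof. by rewrite /verts -map_comp; apply: eq_map => i; rewrite dcompE. Qed.

Lemma verts_clique (X : dimage) n (s : dmap (dsimplex n) X) : clique (verts s).
Proof.
move=> _ _ /mapP[i _ ->] /mapP[j _ ->]; apply: dcontinuous_adjeq (dmap_cont s) _.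
by rewrite /adjeq; case: eqVneq => //= /dsimplex_adj.
Qed.

(** Distinct points of a simplex are adjacent, so continuity only asks that the values form a
    clique. *)
Lemma clique_verts (X : dimage) n (l : seq X) :
  clique l -> size l = n.+1 -> exists s : dmap (dsimplex n) X, verts s = l.
Proof.
case: l => // x0 l cl sl.
pose f (p : dsimplex n) :=
  nth x0 (x0 :: l) (odflt ord0 [pick i : 'I_n.+1 | p == vertex i]).
have fE i : f (vertex i) = nth x0 (x0 :: l) i.
  by rewrite /f; case: pickP => [j /eqP/vertex_inj <-//|/(_ i)]; rewrite eqxx.
have cf : dcontinuous f.
  apply: adjeq_dcontinuous => p q _; have [i ->] := vertexP p; have [j ->] := vertexP q.
  by rewrite !fE; apply: cl; apply: mem_nth; rewrite sl.
exists (mk_dmap cf); apply: (@eq_from_nth _ x0); rewrite size_verts ?sl // => i ilt.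
by rewrite (nth_verts _ _ (Ordinal ilt)) mk_dmapE fE.
Qed.

Lemma verts_face (X : dimage) n (s : dmap (dsimplex n.+1) X) (i : 'I_n.+2) :
  verts (dcomp s (face i)) = take i (verts s) ++ drop i.+1 (verts s).
Proof.
have x0 := s (vertex ord0).
apply: (@eq_from_nth _ x0).
  by rewrite size_cat size_take size_drop !size_verts ltn_ord subSS subnKC // -ltnS.
rewrite size_verts => j jlt; rewrite (nth_verts _ _ (Ordinal jlt)) dcompE faceE.
rewrite -(nth_verts _ x0) /= nth_cat size_take size_verts ltn_ord /bump.
case: ltnP => ij; first by rewrite nth_take.
by rewrite nth_drop addSn subnKC // add1n.
Qed.

(** * Coboundaries and prisms on sequences *)

(* The alternating sum of deletions [sdiffE], in a recursive form that makes
   [prism_sdiff] a plain induction; on singletons it is the augmentation. *)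
Fixpoint sdiff (T : Type) (V : zmodType) (z : seq T -> V) (s : seq T) : V :=
  if s is x :: t then z t - sdiff (fun u => z (x :: u)) t else 0.

Section SequenceCochains.
Variables (S T : Type).

Lemma sdiffB (V : zmodType) (z w : seq T -> V) s :
  sdiff (fun t => z t - w t) s = sdiff z s - sdiff w s.
Proof.
elim: s z w => /= [|x s IH] z w; first by rewrite subr0.
by rewrite IH !opprD !opprK addrACA.
Qed.

Lemma sdiff_pair (V : zmodType) (z : seq T -> V) x y :
  sdiff z [:: x; y] = z [:: y] - z [:: x].
Proof. by rewrite /= subr0. Qed.

Lemma sdiff_map (V : zmodType) (f : S -> T) (z : seq T -> V) s :
  sdiff z (map f s) = sdiff (fun t => z (map f t)) s.
Proof. by elim: s z => //= x s IH z; rewrite IH. Qed.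

Lemma sdiffE (R : pzRingType) (V : lmodType R) (z : seq T -> V) s :
  sdiff z s =
  \sum_(i < size s) ((-1) ^+ i : R) *: z (take i s ++ drop i.+1 s).
Proof.
elim: s z => /= [|x s IH] z; first by rewrite big_ord0.
rewrite big_ord_recl IH scale1r /= drop0 -sumrN; congr (_ + _).
by apply: eq_bigr => i _; rewrite exprS mulN1r scaleNr.
Qed.

End SequenceCochains.

Section Prism.
Variables (X : Type) (Y : eqType) (V : zmodType) (f g : X -> Y).

(** The alternating sum over [i] of [z] at [f x_0, ..., f x_i, g x_i, ..., g x_k]. *)
Fixpoint prism (z : seq Y -> V) (s : seq X) : V :=
  if s is x :: t
  then z (f x :: g x :: map g t) - prism (fun u => z (f x :: u)) t else 0.

Lemma prismB (z w : seq Y -> V) s :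
  prism (fun t => z t - w t) s = prism z s - prism w s.
Proof.
elim: s z w => /= [|x s IH] z w; first by rewrite subr0.
by rewrite IH !opprD !opprK addrACA.
Qed.

(** The cochain homotopy formula, for arbitrary functions of sequences. *)
Lemma prism_sdiff (z : seq Y -> V) s :
  prism (sdiff z) s + sdiff (prism z) s = z (map g s) - z (map f s).
Proof.
elim: s z => [|x s IH] z; first by rewrite /= addr0 subrr.
rewrite /= prismB sdiffB sdiff_map.
have := IH (fun t => z (f x :: t)).
set a := z (g x :: _); set b := z (f x :: _); set b' := z (f x :: map f s).
set c := sdiff _ s; set p := prism z s; set q := prism _ s; set r := sdiff _ s.
rewrite !opprB => Q.
(* The prism on [s] and the deletions behind [f x, g x] cancel; [Q] is the induction hypothesis for
   [z] with [f x] prefixed. *)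
rewrite (AC (((1*2)*2)*(1*2)) ((1*3)*(4*7)*(2*8)*(6*5)))%AC.
by rewrite /= !subrr !addr0 Q subrKA.
Qed.

Lemma prism_eq0 (z : seq Y -> V) s :
  (forall t, size t = (size s).+1 -> {subset t <= map f s ++ map g s} -> z t = 0) ->
  prism z s = 0.
Proof.
elim: s z => //= x s IH z z0.
rewrite z0 /= ?size_map //; last first.
  by move=> y; rewrite !(inE, mem_cat) => /or3P[->|->|->]; rewrite ?orbT.
rewrite sub0r IH ?oppr0 // => t st tfg; apply: z0; first by rewrite /= st.
move=> y; rewrite inE => /orP[/eqP->|/tfg]; first by rewrite inE eqxx.
by rewrite !(inE, mem_cat) => /orP[->|->]; rewrite ?orbT.
Qed.

End Prism.

(** * Cochains as functions of vertex sequences *)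

Section Evaluation.
Variables (R : comPzRingType) (X : dimage) (n : nat).

(** The value 0 on sequences that span no simplex lets [sdiff] and [prism] apply to all
    sequences. *)
Definition seq_eval (z : dual (dchain R n X)) (s : seq X) : R^o :=
  if [pick t : dmap (dsimplex n) X | verts t == s] is Some t
  then z (fbasis R t) else 0.

Definition of_seq (w : seq X -> R^o) : dual (dchain R n X) :=
  linext (fun t : dmap (dsimplex n) X => w (verts t)) :> {linear _ -> _}.

Lemma seq_eval_verts z t : seq_eval z (verts t) = z (fbasis R t).
Proof.
rewrite /seq_eval; case: pickP => [u /eqP/verts_inj->//|/(_ t)].
by rewrite eqxx.
Qed.

Lemma of_seqE w t : of_seq w (fbasis R t) = w (verts t).
Proof. exact: linext_basis. Qed.

Lemma dual_basis_ext (z w : dual (dchain R n X)) :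
  (forall t, z (fbasis R t) = w (fbasis R t)) -> z = w.
Proof. by move=> zw; apply: dual_ext; apply: fbasis_ext. Qed.

End Evaluation.

Lemma coboundaryE (R : comPzRingType) (X : dimage) n
    (w : seq X -> R^o) (z : dual (dchain R n X)) t :
  (forall u, z (fbasis R u) = w (verts u)) ->
  coboundary R n.+1 X z (fbasis R t) = sdiff w (verts t).
Proof.
move=> zw; rewrite (@sdiffE _ R R^o) size_verts /dual_fun /= linext_basis linear_sum.
by apply: eq_bigr => i _; rewrite linearZ -verts_face -zw.
Qed.

(** * Induced maps on cohomology classes *)

Lemma dH_map_class (R : comPzRingType) (X Y : dimage) (f : dmap X Y) n c :
  @dH_map R X Y f n (coh_class _ c) =
  coh_class _ (cocycle_map (@cochain_map_coboundary R X Y f n.+1) c).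
Proof. exact: (coh_mapE (@cochain_map_coboundary R X Y f n)). Qed.

Lemma coh_class0 (R : pzRingType) (U V W : lmodType R)
    (d : {linear U -> V}) (e : {linear V -> W}) :
  coh_class d (0 : cocycle e) = 0.
Proof. by apply: (@addrI _ (coh_class d 0)); rewrite -coh_class_add !addr0. Qed.

Section Functoriality.
Variable R : comPzRingType.

Lemma cocycle_mapE (X Y : dimage) (f : dmap X Y) n
    (z : cocycle (coboundary R n.+1 Y)) s :
  (val (cocycle_map (@cochain_map_coboundary R X Y f n.+1) z) : dual (dchain R n X))
    (fbasis R s) = (val z : dual (dchain R n Y)) (fbasis R (dcomp f s)).
Proof. by rewrite /= {1}/dual_fun /= linext_basis. Qed.

Lemma dH_map_id (X : dimage) (f : dmap X X) n (y : dH R X n) :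
  f =1 id -> dH_map f y = y.
Proof.
move=> fid; rewrite -[y]coh_classK dH_map_class; congr coh_class.
apply/val_inj/dual_basis_ext => s; rewrite cocycle_mapE.
by congr (_ (fbasis _ _)); apply: dmapP => p; rewrite dcompE fid.
Qed.

Lemma dH_mapD (X Y : dimage) (f : dmap X Y) n : {morph @dH_map R X Y f n : y z / y + z}.
Proof. exact: raddfD. Qed.

Lemma dH_map_comp (X Y Z : dimage) (g : dmap Y Z) (f : dmap X Y) n (y : dH R Z n) :
  dH_map (dcomp g f) y = dH_map f (dH_map g y).
Proof.
rewrite -[y]coh_classK !dH_map_class; congr coh_class.
apply/val_inj/dual_basis_ext => s; rewrite !cocycle_mapE.
by congr (_ (fbasis _ _)); apply: dmapP => p; rewrite !dcompE.
Qed.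

Lemma dH_map_eq (X Y : dimage) (f g : dmap X Y) n
    (z : cocycle (coboundary R n.+1 Y)) (w : dual (dchain R n.-1 X)) :
  (forall s, val z (fbasis R (dcomp f s)) - val z (fbasis R (dcomp g s))
             = coboundary R n X w (fbasis R s)) ->
  @dH_map R X Y f n (coh_class _ z) = dH_map g (coh_class _ z).
Proof.
move=> zw; rewrite !dH_map_class; apply/coh_class_eq; exists w.
apply: dual_basis_ext => s; apply: etrans (zw s).
by congr (_ - _); [exact: (cocycle_mapE f z s)|exact: (cocycle_mapE g z s)].
Qed.

Lemma cocycle_sdiff (X : dimage) n (z : cocycle (coboundary R n.+1 X)) (s : seq X) :
  clique s -> size s = n.+2 ->
  sdiff (seq_eval (val z : dual (dchain R n X))) s = 0.
Proof.
move=> cs ss; have [t <-] := clique_verts cs ss.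
rewrite -(@coboundaryE R X n _ (val z)) => [|u]; last by rewrite seq_eval_verts.
have /eqP := valP z; exact: (congr1 (fun c : dual (dchain R n.+1 X) => c (fbasis R t))).
Qed.

End Functoriality.

(** * Contiguous maps in positive degree *)

(* A digital homotopy only relates [f x] to [g x]; contiguity also relates [f x]
   to [g x'] for x' adjacent to x, so that prisms have simplices as faces. *)
Definition contiguous (X Y : dimage) (f g : X -> Y) : Prop :=
  forall x x', adjeq x x' ->
  [/\ adjeq (f x) (f x'), adjeq (g x) (g x') & adjeq (f x) (g x')].

(** Prisms over a simplex are cliques, where the coboundary of a cocycle vanishes, so the prism
    formula leaves only a coboundary. *)
Lemma contiguous_dH_map (R : comPzRingType) (X Y : dimage) (f g : dmap X Y) n
    (y : dH R Y n.+1) :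
  contiguous f g -> dH_map f y = dH_map g y.
Proof.
move=> fg; rewrite -[y]coh_classK; set z := repr y.
pose zs := seq_eval (val z : dual (dchain R n.+1 Y)).
apply: (@dH_map_eq _ _ _ _ _ n.+1 z (of_seq n (prism g f zs))) => s.
rewrite (@coboundaryE _ _ _ (prism g f zs)); last exact: of_seqE.
have := prism_sdiff g f zs (verts s).
rewrite prism_eq0 ?add0r => [->|t st tgf].
  by rewrite /zs -!verts_dcomp !seq_eval_verts.
apply: cocycle_sdiff; last by rewrite st size_verts.
move=> u v /tgf ut /tgf vt.
have fgs w : w \in map g (verts s) ++ map f (verts s) ->
    exists2 a, a \in verts s & w = g a \/ w = f a.
  by rewrite mem_cat => /orP[]/mapP[a sa ->]; exists a; auto.
have [a sa ua] := fgs u ut; have [b sb vb] := fgs v vt.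
have ab := verts_clique sa sb; have [? ? ?] := fg a b ab.
have [|_ _ ?] := fg b a; first by rewrite adjeq_sym.
by case: ua vb => -> [] ->; rewrite // adjeq_sym.
Qed.

(** * Locally constant maps in positive degree *)

Lemma sum_signs (R : pzRingType) n : \sum_(i < n) (-1) ^+ i = (odd n)%:R :> R.
Proof.
elim: n => [|n IH]; first by rewrite big_ord0.
rewrite big_ord_recr IH /= -signr_odd; case: (odd n); rewrite ?expr1 ?subrr //.
by rewrite expr0 add0r.
Qed.

Lemma sdiff_cst (R : pzRingType) (V : lmodType R) (T : Type) (z : seq T -> V)
    (s : seq T) (c : V) :
  (forall i, (i < size s)%N -> z (take i s ++ drop i.+1 s) = c) ->
  sdiff z s = (odd (size s))%:R *: c.
Proof.
move=> zc; rewrite (@sdiffE _ R) -sum_signs scaler_suml.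
by apply: eq_bigr => i _; rewrite zc.
Qed.

Lemma size_delete (T : Type) (s : seq T) i :
  (i < size s)%N -> size (take i s ++ drop i.+1 s) = (size s).-1.
Proof.
move=> ilt; rewrite size_cat size_take size_drop ilt.
by case: (size s) ilt => // m; rewrite subSS ltnS => /subnKC.
Qed.

Lemma mem_delete (T : eqType) (s : seq T) i : {subset take i s ++ drop i.+1 s <= s}.
Proof. by move=> x; rewrite mem_cat => /orP[/mem_take|/mem_drop]. Qed.

Lemma eq_nseq (T : eqType) (s : seq T) x :
  (forall y, y \in s -> y = x) -> s = nseq (size s) x.
Proof. by move=> sx; apply/all_pred1P/allP => y /sx ->; rewrite /= eqxx. Qed.

Lemma clique_nseq (X : dimage) n (x : X) : clique (nseq n x).
Proof.
move=> a b an bn; have [-> _] := elimT (@nseqP X n x a) an.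
by have [-> _] := elimT (@nseqP X n x b) bn; apply: adjeq_refl.
Qed.

(** Simplices go to constant ones, whose faces all agree; by parity the pulled-back cocycle is 0 or
    the coboundary of [w]. *)
Lemma locally_constant_dH_map (R : comPzRingType) (X Y : dimage) (f : dmap X Y) n
    (y : dH R Y n.+1) :
  (forall x x', adj x x' -> f x = f x') -> dH_map f y = 0.
Proof.
move=> fc; rewrite -[y]coh_classK; set z := repr y.
pose zs := seq_eval (val z : dual (dchain R n.+1 Y)).
have fc' x x' : adjeq x x' -> f x = f x' by case/orP => [/eqP->|/fc].
(* For even [n], the alternating sum over [n.+3] equal faces is a single term, which the cocycle
   condition makes 0. *)
have zcst v : zs (nseq n.+2 v) = (odd n)%:R *: zs (nseq n.+2 v).
  have : sdiff zs (nseq n.+3 v) = (odd n.+3)%:R *: zs (nseq n.+2 v).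
    rewrite (@sdiff_cst R _ _ _ _ (zs (nseq n.+2 v))) size_nseq // => i ilt.
    congr zs; apply: etrans (eq_nseq (x := v) _) _; last first.
      by rewrite size_delete size_nseq.
    by move=> x /mem_delete xv; have [] := elimT (@nseqP Y n.+3 v x) xv.
  rewrite cocycle_sdiff; first last.
  - by rewrite size_nseq.
  - exact: (@clique_nseq Y n.+3 v).
  rewrite /= negbK; case: (odd n) => /= [_|]; rewrite scale1r // => <-.
  by rewrite scaler0.
(* Any vertex could represent the simplex, as [f] is constant on it; the empty sequence never
   occurs. *)
pose w (t : seq X) : R^o := if t is x :: _ then zs (nseq n.+2 (f x)) else 0.
rewrite dH_map_class -(coh_class0 (coboundary R n.+1 X)); apply/coh_class_eq.
exists (of_seq n w); apply: dual_basis_ext => s.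
rewrite subr0; apply: etrans (cocycle_mapE f z s) _.
apply/esym; apply: etrans (@coboundaryE R X n w _ s (of_seqE w)) _.
pose x0 : X := (s : dmap (dsimplex n.+1) X) (vertex ord0).
rewrite -seq_eval_verts verts_dcomp.
have xs x : x \in verts s -> f x = f x0.
  move=> sx; apply: fc'; apply: verts_clique sx _.
  by rewrite /x0 -(nth_verts s x0 ord0) mem_nth ?size_verts.
have -> : map f (verts s) = nseq n.+2 (f x0).
  rewrite -(size_verts s) -(size_map f); apply: eq_nseq => _ /mapP[x sx ->].
  exact: xs.
rewrite (@sdiff_cst R _ _ _ _ (zs (nseq n.+2 (f x0)))) ?size_verts /= ?negbK -?zcst //.
move=> i ilt; rewrite /w; case E : (_ ++ _) => [|x t].
  by have := size_delete (s := verts s) (i := i); rewrite E size_verts => /(_ ilt).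
by rewrite (xs x) // (@mem_delete X (verts s) i) // E inE eqxx.
Qed.

(** A 0-cocycle agrees at adjacent points, hence along the track of each [x] from [f x] to [g x]. *)
Lemma dhomotopic_dH0_map (R : comPzRingType) (X Y : dimage) (f g : dmap X Y)
    (y : dH R Y 0) :
  dhomotopic f g -> dH_map f y = dH_map g y.
Proof.
move=> [m [_ [F [F0 F1 Fc _]]]]; rewrite -[y]coh_classK; set z := repr y.
pose zs := seq_eval (val z : dual (dchain R 0 Y)).
have zs_adjeq u v : adjeq u v -> zs [:: u] = zs [:: v].
  move=> uv; apply/esym/subr0_eq; rewrite -sdiff_pair.
  apply: cocycle_sdiff => // a b; rewrite !inE.
  by move=> /orP[]/eqP-> /orP[]/eqP->; rewrite ?adjeq_refl // adjeq_sym.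
have ipt_adjeq (i j : 'I_m.+1) : j = i.+1 :> nat -> adjeq (ipt i) (ipt j).
  move=> ji; apply/orP; right; rewrite /= /kadj /=; apply/and3P; split.
  - apply/eqP => /rowP/(_ ord0); rewrite !mxE ji => /eqP.
    by rewrite eqz_nat eqn_leq ltnn andbF.
  - by rewrite -[X in (_ <= X)%N]card_ord max_card.
  - apply/forallP => k; rewrite !mxE ji; apply/orP; left.
    by rewrite distrC -natz -[i%:Z]natz mulrSr addrAC subrr add0r normr1.
have zsF x (i : 'I_m.+1) : zs [:: F x (ipt i)] = zs [:: f x].
  case: i => i; elim: i => [|i IH] im.
    by rewrite -F0; congr (zs [:: F x (ipt _)]); apply: val_inj.
  rewrite -(IH (ltnW im)); apply/esym/zs_adjeq/(dcontinuous_adjeq (Fc x)).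
  exact: ipt_adjeq.
apply: (@dH_map_eq _ _ _ _ _ 0 z 0) => s.
have fgs : zs (verts (dcomp f s)) = zs (verts (dcomp g s)).
  have [x sx] : exists x, verts s = [:: x].
    by have := size_verts s; case: (verts s) => [|x []] // _; exists x.
  by rewrite !verts_dcomp sx /= -F1 zsF.
have -> : coboundary R 0 X 0 = 0 by exact: linear0.
move: fgs; rewrite /zs !seq_eval_verts => fgs.
by apply/eqP; rewrite subr_eq0; apply/eqP.
Qed.

(** * Vanishing of primitive classes in positive degree *)

Section Primitive.
Variables (R : comPzRingType) (K : product_structure) (Y : dimage).
Variables (m : dmap (dprod K Y Y) Y) (n : nat) (y : dH R Y n.+1).

(* Continuity of diagonals and of products of maps out of an edge forces the
   adjacency of the product to contain the strong product adjacency. *)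
Lemma ppair_adjeq (a a' c c' : Y) :
  adjeq a a' -> adjeq c c' -> adjeq (ppair K a c) (ppair K a' c').
Proof.
have edge (u v : Y) : adjeq u v ->
    exists e : dmap (dsimplex 1) Y, e (vertex ord0) = u /\ e (vertex ord_max) = v.
  move=> uv; have cl : clique [:: u; v].
    move=> p q; rewrite !inE.
    by move=> /orP[]/eqP-> /orP[]/eqP->; rewrite ?adjeq_refl // adjeq_sym.
  have [e ee] := clique_verts (n := 1) cl erefl.
  by exists e; rewrite -!(nth_verts e u) ee.
move=> /edge[e [<- <-]] /edge[e' [<- <-]].
pose d := mk_dmap (dcontinuous_comp (@pmap_cont K _ _ _ _ e e')
                                    (@diag_cont K (dsimplex 1))).
have := @dcontinuous_adjeq _ _ d (vertex ord0) (vertex ord_max) (dmap_cont d).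
rewrite !mk_dmapE !ppairK1 !ppairK2; apply.
by apply/orP; right; apply: dsimplex_adj; apply/eqP => /vertex_inj.
Qed.

Lemma mul_adjeq (a a' c c' : Y) :
  adjeq a a' -> adjeq c c' -> adjeq (m (ppair K a c)) (m (ppair K a' c')).
Proof.
by move=> aa' cc'; apply: dcontinuous_adjeq (dmap_cont m) (ppair_adjeq aa' cc').
Qed.

Definition ltrans (x : Y) : dmap Y Y := dcomp m (mk_dmap (@inr_cont K Y Y x)).
Definition rtrans (x : Y) : dmap Y Y := dcomp m (mk_dmap (@inl_cont K Y Y x)).

Hypothesis yP :
  dH_map m y = dH_map (proj1_dmap K Y Y) y + dH_map (proj2_dmap K Y Y) y.

(** On the slice over [x] the first projection is constant, contributing 0, and the second is the
    identity. *)
Lemma ltrans_fix x : dH_map (ltrans x) y = y.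
Proof.
rewrite dH_map_comp yP dH_mapD -!dH_map_comp.
rewrite locally_constant_dH_map ?add0r => [|a b _].
  by apply: dH_map_id => a; rewrite dcompE !mk_dmapE ppairK2.
by rewrite !dcompE !mk_dmapE !ppairK1.
Qed.

Lemma rtrans_fix x : dH_map (rtrans x) y = y.
Proof.
rewrite dH_map_comp yP dH_mapD -!dH_map_comp addrC.
rewrite locally_constant_dH_map ?add0r => [|a b _].
  by apply: dH_map_id => a; rewrite dcompE !mk_dmapE ppairK1.
by rewrite !dcompE !mk_dmapE !ppairK2.
Qed.

Section Collapse.
Variables b b' : Y.
Hypotheses (bb' : adjeq b b') (nbb' : b != b').

Definition word_mul (w : seq bool) : Y :=
  foldr (fun e c => m (ppair K (if e then b' else b) c)) b w.

Lemma word_mul_adjeq w w' :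
  size w = size w' -> adjeq (word_mul w) (word_mul w').
Proof.
elim: w w' => [|e w IH] [|e' w'] //= => [_|[ww']]; first exact: adjeq_refl.
apply: mul_adjeq (IH _ ww').
by case: e e' => [] []; rewrite ?adjeq_refl // adjeq_sym.
Qed.

Lemma word_mul_not_inj :
  exists w w', [/\ size w = size w', w != w' & word_mul w = word_mul w'].
Proof.
pose h (w : #|Y|.-tuple bool) := word_mul w.
have /injectivePn[w [w' ww' hw]] : ~~ injectiveb h.
  (* There are [2 ^ #|Y|] words, more than points of [Y]. *)
  apply/negP => /injectiveP/leq_card; rewrite card_tuple card_bool.
  by rewrite leqNgt ltn_expl.
by exists w, w'; rewrite !size_tuple; split.
Qed.

(** Common first letters move into [Q] as left translations, which fix [y]. At the first difference
    the remaining words have equal length, so their products are adjacent or equal. *)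
Lemma first_difference w w' (Q : dmap Y Y) :
  size w = size w' -> w != w' -> Q (word_mul w) = Q (word_mul w') ->
  dH_map Q y = y ->
  exists (P : dmap Y Y) (c c' : Y),
    [/\ adjeq c c', dH_map P y = y
      & P (m (ppair K b c)) = P (m (ppair K b' c'))].
Proof.
elim: w w' Q => [|e w IH] [|e' w'] Q //= [sw]; rewrite eqseq_cons.
have [<- /= ww' Qw Qy|ee' _ Qw Qy] := eqVneq e e'.
  apply: (IH w' (dcomp Q (ltrans (if e then b' else b)))) => //.
    by rewrite !dcompE !mk_dmapE.
  by rewrite dH_map_comp Qy ltrans_fix.
case: e e' ee' Qw => [] [] // _ Qw.
  by exists Q, (word_mul w'), (word_mul w); split=> //; apply: word_mul_adjeq.
by exists Q, (word_mul w), (word_mul w'); split=> //; apply: word_mul_adjeq.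
Qed.

Lemma collapse_edge : exists H : dmap Y Y, dH_map H y = y /\ H b = H b'.
Proof.
have [w [w' [sw ww' mw]]] := word_mul_not_inj.
have [P [c [c' [cc' Py Pbb']]]] : exists (P : dmap Y Y) (c c' : Y),
    [/\ adjeq c c', dH_map P y = y & P (m (ppair K b c)) = P (m (ppair K b' c'))].
  by apply: (first_difference (Q := ltrans b) sw ww'); rewrite ?mw ?ltrans_fix.
pose h (a : Y) : Y := P (m (ppair K a (if a == b' then c' else c))).
have cont a a' (d d' : Y) : adjeq a a' -> d \in [:: c; c'] -> d' \in [:: c; c'] ->
    adjeq (P (m (ppair K a d))) (P (m (ppair K a' d'))).
  move=> aa' dc dc'; apply: dcontinuous_adjeq (dmap_cont P) (mul_adjeq aa' _).
  by move: dc dc'; rewrite !inE => /orP[]/eqP-> /orP[]/eqP->;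
    rewrite ?adjeq_refl // adjeq_sym.
have hc a : (if a == b' then c' else c) \in [:: c; c'].
  by case: ifP; rewrite !inE eqxx ?orbT.
have cc : c \in [:: c; c'] by rewrite inE eqxx.
have hcont : dcontinuous h.
  by apply: adjeq_dcontinuous => a a' aa'; apply: cont; rewrite /adjeq ?aa' ?orbT.
exists (mk_dmap hcont); split; last by rewrite !mk_dmapE /h eqxx (negbTE nbb').
(* By [cont], choosing between [c] and [c'] in the second factor never breaks adjacency, whence
   contiguity. *)
have -> : dH_map (mk_dmap hcont) y = dH_map (dcomp P (rtrans c)) y.
  apply: contiguous_dH_map => a a' aa'.
  have PE u : dcomp P (rtrans c) u = P (m (ppair K u c)).
    by rewrite dcompE dcompE mk_dmapE.
  by rewrite !PE !(mk_dmapE hcont); split; apply: cont.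
by rewrite dH_map_comp Py rtrans_fix.
Qed.

End Collapse.

Lemma fixed_eq0 (G : dmap Y Y) : dH_map G y = y -> y = 0.
Proof.
have [k] := ubnP #|G @: Y|; elim: k G => // k IH G Gk Gy.
have [[a [a' [aa' Gaa']]]|Gcst] :=
    pselect (exists a a' : Y, adj a a' /\ G a != G a').
  have bb' : adjeq (G a) (G a').
    by apply: dcontinuous_adjeq (dmap_cont G) _; rewrite /adjeq aa' orbT.
  have [H [Hy HG]] := collapse_edge bb' Gaa'.
  apply: (IH (dcomp H G)); last by rewrite dH_map_comp Hy.
  apply: leq_trans (_ : #|G @: Y| <= k)%N; last by rewrite -ltnS.
  have -> : dcomp H G @: Y = H @: (G @: Y).
    by rewrite -imset_comp; apply: eq_imset => x; rewrite /= dcompE.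
  (* [H] identifies the distinct points [G a] and [G a'], so the image shrinks strictly. *)
  rewrite ltn_neqAle leq_imset_card andbT; apply/imset_injP => Hinj.
  by have := Hinj _ _ (imset_f G (erefl true)) (imset_f G (erefl true)) HG; apply/eqP.
rewrite -Gy; apply: locally_constant_dH_map => x x' xx'.
by apply/eqP; apply: contra_notT Gcst => nx; exists x, x'.
Qed.

End Primitive.

Theorem proposition4p8 (R : comPzRingType) (K : product_structure)
    (X Y : hopf_space K) (f : dmap X Y) (hf : hopf_function f) :
  (dHs_map R f @` PdHs R Y `<=` PdHs R X)%classic.
Proof.
move=> _ [y yP <-]; apply: dsum_ext => n.
have yPn : dH_map (hmul Y) (y n) =
    dH_map (proj1_dmap K Y Y) (y n) + dH_map (proj2_dmap K Y Y) (y n).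
  exact: (congr1 (fun z : dHs R _ => z n) yP).
change (dH_map (hmul X) (dH_map f (y n)) =
  dH_map (proj1_dmap K X X) (dH_map f (y n)) +
  dH_map (proj2_dmap K X X) (dH_map f (y n))).
(* In positive degree [y n] is fixed by a translation, hence 0. *)
case: n yPn => [|n] yPn; last first.
  by rewrite (fixed_eq0 yPn (ltrans_fix yPn (hbase Y))) !raddf0 addr0.
(* In degree 0 the homotopy replaces [f] after the product of [X] by the product of [Y] after [f]
   times [f], which commutes with the projections. *)
rewrite -!dH_map_comp (dhomotopic_dH0_map _ hf) dH_map_comp yPn dH_mapD -!dH_map_comp.
have -> : dcomp (proj1_dmap K Y Y) (prod_dmap K f f) = dcomp f (proj1_dmap K X X).
  by apply: dmapP => p; rewrite !dcompE !mk_dmapE ppairK1.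
have -> // : dcomp (proj2_dmap K Y Y) (prod_dmap K f f) = dcomp f (proj2_dmap K X X).
by apply: dmapP => p; rewrite !dcompE !mk_dmapE ppairK2.
Qed.
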